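(* Let $k\ge1$, $n\ge2$ and $T'\in\mathcal T^k_{n-1}$ with bottom row entries $b'_1<\dots<b'_{n-1}$. Then the number of $T\in\mathcal T^k_n$ with $\mathrm{red}(T)=T'$ equals $b'_1$ (the last entry of the first column of $T'$). Moreover, if $b_1<\dots<b_n$ are the bottom row entries of such a $T$, then $b_j=b'_{j-1}+k+1$ for $2\le j\le n$, and $b_1$ can be any one of the $b'_1$ numbers $k+1,k+2,\dots,k+b'_1$ (each choice giving exactly one such $T$).
   Context: $\mathcal T^k_n$ is the set of arrays with $k+1$ rows and $n$ columns containing each of $1,\dots,(k+1)n$ once, increasing along rows and down columns, such that whenever $a<b<c<d$ with $d$ immediately below $a$, the entries $b$ and $c$ are not in the same column. The bottom row is row $k+1$. For $T\in\mathcal T^k_n$, $\mathrm{red}(T)$ is obtained by deleting the first column of $T$ and replacing the remaining entries by $1,\dots,(k+1)(n-1)$ in an order-preserving way. *)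

(* Defs.v *)
From HB Require Import structures.
From mathcomp Require Import all_boot all_order all_algebra.

Set Implicit Arguments.
Unset Strict Implicit.
Unset Printing Implicit Defensive.

(* Rows and columns are indexed from 0. Entries are bounded naturals: the value
   v : 'I_(k.+1 * n).+1 stands for the number v itself, so the entries of
   interest are 1, ..., (k+1)n and the spare value 0 is excluded by each_once
   (there are only (k+1)n cells). The bound makes the type of arrays finite. *)
Notation array k n := 'M['I_(k.+1 * n).+1]_(k.+1, n).

Section Tableaux.
Variables k n : nat.
Implicit Type T : array k n.

Definition each_once T : bool :=
  [forall v : 'I_(k.+1 * n).+1, (0 < v) ==>
     (#|[set p : 'I_k.+1 * 'I_n | T p.1 p.2 == v]| == 1)].

Definition rows_increasing T : bool :=
  [forall i : 'I_k.+1, forall j1 : 'I_n, forall j2 : 'I_n,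
     (j1 < j2) ==> (T i j1 < T i j2)].

Definition columns_increasing T : bool :=
  [forall j : 'I_n, forall i1 : 'I_k.+1, forall i2 : 'I_k.+1,
     (i1 < i2) ==> (T i1 j < T i2 j)].

(* a = T i j, d = T i' j with i' = i + 1; b and c are two entries of column l *)
Definition column_avoiding T : bool :=
  [forall i : 'I_k.+1, forall i' : 'I_k.+1, forall j : 'I_n,
   forall l : 'I_n, forall r : 'I_k.+1, forall s : 'I_k.+1,
     (i' == i.+1 :> nat) ==>
       ~~ [&& T i j < T r l, T r l < T s l & T s l < T i' j]].

Definition tableaux : {set array k n} :=
  [set T : array k n | [&& each_once T, rows_increasing T, columns_increasing T
                         & column_avoiding T]].

Definition bottom T (j : 'I_n) : nat := T ord_max j.

End Tableaux.

Arguments tableaux : clear implicits.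

Section Reduction.
Variables k n : nat.
Implicit Type T : array k n.+1.

(* When the remaining entries are distinct, the order-preserving relabelling by
   1, 2, ... sends an entry x to the number of remaining entries that are <= x. *)
Definition red_rank T (i : 'I_k.+1) (j : 'I_n) : nat :=
  #|[set p : 'I_k.+1 * 'I_n | T p.1 (lift ord0 p.2) <= T i (lift ord0 j)]|.

Definition red T : array k n := \matrix_(i, j) inord (red_rank T i j).

Lemma red_rankE T i j : red T i j = red_rank T i j :> nat.
Proof.
rewrite mxE inordK // ltnS /red_rank.
by apply: leq_trans (max_card _) _; rewrite card_prod !card_ord.
Qed.

Lemma red_lt T i j i' j' :
  (red T i j < red T i' j') = (T i (lift ord0 j) < T i' (lift ord0 j')).
Proof.
rewrite !red_rankE /red_rank.
case: (ltnP (T i (lift ord0 j))) => [lt_T|ge_T].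
  apply/proper_card/properP; split.
    by apply/subsetP=> p; rewrite !inE => /leq_trans; apply; apply: ltnW.
  by exists (i', j'); rewrite !inE //= -ltnNge.
apply/negbTE; rewrite -leqNgt; apply/subset_leq_card/subsetP=> p.
by rewrite !inE => /leq_trans; apply.
Qed.

End Reduction.

(* Main.v *)
Require Import Defs.
From HB Require Import structures.
From mathcomp Require Import all_boot all_order all_algebra.
From mathcomp Require Import zify.

(** Write [h_j(c)] for the number of entries [<= c] in column [j] of [T'].  A
    first column [x_0 < ... < x_k] added to [T'] is encoded by the numbers
    [c_i] of entries of [T'] relabelled below [x_i], so that
    [x_i = c_i + i + 1].  Avoidance between the new column and the old ones
    says exactly that [h_j(c_i) = max(h_j(c_{i+1}) - 1, 0)] for all [j]: hence
    [c_i] is determined by [c_{i+1}], and everything by [c_k].  Conversely, if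
    [c < b'_1], avoidance in [T'] makes the entries [<= c] that are not last
    among those of their column an initial segment [1, ..., c'], so [c_i := c']
    does solve the equations for [c_{i+1} = c].  Thus [c_k] ranges freely over
    [0, ..., b'_1 - 1]. *)

Set Implicit Arguments.
Unset Strict Implicit.
Unset Printing Implicit Defensive.

(** * Entries as a permutation of an initial segment *)

Section Entries.
Variables k n : nat.
Implicit Type T : array k n.

Definition entry T (p : 'I_k.+1 * 'I_n) : nat := T p.1 p.2.

Lemma count_entry T (a : pred nat) :
  count a [seq entry T p | p <- enum {: 'I_k.+1 * 'I_n}] =
  #|[set p | a (entry T p)]|.
Proof. by rewrite count_map cardsE cardE size_filter enumT. Qed.

Lemma size_entries T :
  size [seq entry T p | p <- enum {: 'I_k.+1 * 'I_n}] = k.+1 * n.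
Proof. by rewrite size_map -cardE card_prod !card_ord. Qed.

(** Pigeonhole: there are as many cells as nonzero values, so once every nonzero value occurs, no
    cell is left for 0 or for a repetition. *)
Lemma each_once_perm T :
  each_once T = perm_eq [seq entry T p | p <- enum {: 'I_k.+1 * 'I_n}]
                        (iota 1 (k.+1 * n)).
Proof.
apply/forallP/idP => [once|pe v].
  rewrite perm_sym; have sub : {subset iota 1 (k.+1 * n) <=
      [seq entry T p | p <- enum {: 'I_k.+1 * 'I_n}]}.
    move=> v; rewrite mem_iota add1n => /andP[v_gt0 v_lt].
    have /implyP/(_ v_gt0)/eqP := once (Ordinal v_lt).
    case/eqP/cards1P=> p /setP/(_ p); rewrite !inE eqxx => /eqP eq_v.
    by apply/mapP; exists p; rewrite ?mem_enum // /entry eq_v.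
  have [|_ eq_mem] := uniq_min_size (iota_uniq _ _) sub.
    by rewrite size_entries size_iota.
  apply: uniq_perm => //; first exact: iota_uniq.
  by rewrite (leq_size_uniq (iota_uniq _ _) sub) // size_entries size_iota.
apply/implyP=> v_gt0; apply/eqP.
transitivity (count_mem (nat_of_ord v) (iota 1 (k.+1 * n))).
  by rewrite -(permP pe) count_entry; apply: eq_card => p; rewrite !inE.
by rewrite count_uniq_mem ?iota_uniq // mem_iota v_gt0 add1n ltn_ord.
Qed.

Lemma each_once_inj T :
  (forall p, 0 < entry T p) -> injective (entry T) -> each_once T.
Proof.
move=> T_gt0 injT; rewrite each_once_perm.
have uT : uniq [seq entry T p | p <- enum {: 'I_k.+1 * 'I_n}].
  by rewrite map_inj_uniq // enum_uniq.
have sub : {subset [seq entry T p | p <- enum {: 'I_k.+1 * 'I_n}]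
               <= iota 1 (k.+1 * n)}.
  by move=> _ /mapP[p _ ->]; rewrite mem_iota T_gt0 add1n ltn_ord.
have [|_ eq_mem] := uniq_min_size uT sub.
  by rewrite size_entries size_iota.
by apply: uniq_perm => //; apply: iota_uniq.
Qed.

Section EachOnce.
Variable T : array k n.
Hypothesis onceT : each_once T.

Lemma entry_inj : injective (entry T).
Proof.
have := onceT; rewrite each_once_perm => /perm_uniq; rewrite iota_uniq => uT.
exact/injectiveP.
Qed.

Lemma entry_gt0 i j : 0 < T i j.
Proof.
have := onceT; rewrite each_once_perm => /perm_mem /(_ (T i j)).
rewrite mem_iota (map_f (entry T) (x := (i, j))) ?mem_enum //.
by case: (0 < T i j).
Qed.

(** Every entry is thus its own rank, which lets values be compared through inclusions of sets of
    cells. *)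
Lemma card_entry_le v :
  v <= k.+1 * n -> #|[set p | entry T p <= v]| = v.
Proof.
move=> le_v; have := onceT; rewrite each_once_perm => /permP/(_ (leq^~ v)).
rewrite count_entry => ->; rewrite -[in LHS](subnKC le_v) iotaD count_cat.
rewrite -[RHS]addn0; congr (_ + _).
  rewrite -[RHS](size_iota 1); apply/eqP; rewrite -all_count.
  by apply/allP=> x; rewrite mem_iota; lia.
apply/eqP; rewrite -[_ == _]negbK -lt0n -has_count; apply/hasPn=> x.
by rewrite mem_iota; lia.
Qed.

End EachOnce.
End Entries.

(** * Adjacent rows and the order conditions of a tableau *)

Definition next k (r : 'I_k.+1) : 'I_k.+1 := inord r.+1.

(** At the last row [inord] falls back to row 0, hence the guard [r < k]. *)
Lemma nextE k (r : 'I_k.+1) : r < k -> next r = r.+1 :> nat.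
Proof. by move=> lt_rk; rewrite inordK. Qed.

Section TableauTheory.
Variables (k n : nat) (T : array k n).
Hypothesis tabT : T \in tableaux k n.

Lemma tableaux_each_once : each_once T.
Proof. by move: tabT; rewrite inE => /and4P[]. Qed.

Lemma tableaux_row i (j1 j2 : 'I_n) : j1 < j2 -> T i j1 < T i j2.
Proof.
move: tabT; rewrite inE => /and4P[_ /forallP/(_ i)/forallP/(_ j1) h _ _].
by move/forallP: h => /(_ j2)/implyP.
Qed.

Lemma tableaux_row_le i (j1 j2 : 'I_n) : j1 <= j2 -> T i j1 <= T i j2.
Proof.
rewrite leq_eqVlt => /predU1P[/val_inj->//|/tableaux_row lt_T].
exact: ltnW.
Qed.

Lemma tableaux_col (i1 i2 : 'I_k.+1) j : i1 < i2 -> T i1 j < T i2 j.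
Proof.
move: tabT; rewrite inE => /and4P[_ _ /forallP/(_ j)/forallP/(_ i1) h _].
by move/forallP: h => /(_ i2)/implyP.
Qed.

Lemma tableaux_col_le (i1 i2 : 'I_k.+1) j : i1 <= i2 -> T i1 j <= T i2 j.
Proof.
rewrite leq_eqVlt => /predU1P[/val_inj->//|/tableaux_col lt_T].
exact: ltnW.
Qed.

Lemma tableaux_next (i : 'I_k.+1) j : i < k -> T i j < T (next i) j.
Proof. by move=> lt_ik; apply: tableaux_col; rewrite nextE. Qed.

Lemma tableaux_avoid (i r s : 'I_k.+1) j l :
  i < k -> T i j < T r l -> T r l < T s l -> T s l < T (next i) j -> False.
Proof.
move=> lt_ik h1 h2 h3; move: tabT; rewrite inE => /and4P[_ _ _].
move=> /forallP/(_ i)/forallP/(_ (next i))/forallP/(_ j)/forallP/(_ l).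
move=> /forallP/(_ r)/forallP/(_ s); rewrite nextE // eqxx.
by rewrite h1 h2 h3.
Qed.

End TableauTheory.

Lemma card_cells_split k n (P : pred ('I_k.+1 * 'I_n.+1)) :
  #|[set p | P p]| =
  #|[set r | P (r, ord0)]| + #|[set q | P (q.1, lift ord0 q.2)]|.
Proof.
rewrite !cardsE -!sum1_card !(big_mkcond (fun _ => _ \in _)) /=.
rewrite (eq_bigr (fun p => (P (p.1, p.2) : nat))); last first.
  by case=> i j _; rewrite unfold_in; case: (P _).
rewrite -(pair_bigA _ (fun i j => (P (i, j) : nat))) /=.
rewrite (eq_bigr (fun i => (P (i, ord0) : nat) +
           \sum_(j < n) (P (i, lift ord0 j) : nat))); last first.
  by move=> i _; rewrite big_ord_recl.
rewrite big_split /= pair_bigA /=.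
by congr (_ + _); apply: eq_bigr => i _; rewrite unfold_in; case: (P _).
Qed.

(** * Gap sequences and the recursion that determines them *)

Section Extension.
Variables (k n : nat) (T' : array k n.+1).
Hypothesis tabT' : T' \in tableaux k n.+1.
Implicit Type c : 'I_k.+1 -> nat.

Let onceT' := tableaux_each_once tabT'.

(** An entry [<= m] is not last among those of its column exactly when its lower neighbour is still
    [<= m]; the number of such cells is the [c'] of the overview. *)
Definition nonlast m :=
  [set p : 'I_k.+1 * 'I_n.+1 | (p.1 < k) && (T' (next p.1) p.2 <= m)].

Definition pred_gap m := #|nonlast m|.

(* Since [h_j(c)] counts the rows [r] with [T' r j <= c], the second clause is
   [h_j(c_i) = max(h_j(c_{i+1}) - 1, 0)]. *)
Definition valid_gaps c :=
  (forall i, c i < T' i ord0) /\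
  (forall (i r : 'I_k.+1) j, i < k -> r < k ->
     (T' r j <= c i) = (T' (next r) j <= c (next i))).

(** By [down], [nonlast m] is closed under passing to smaller entries, so its entries are
    [1, ..., pred_gap m]. *)
Lemma leq_pred_gap m (r : 'I_k.+1) j :
  m < T' ord_max ord0 -> r < k -> (T' r j <= pred_gap m) = (T' (next r) j <= m).
Proof.
move=> lt_m lt_rk.
have down p q : q \in nonlast m -> entry T' p < entry T' q -> p \in nonlast m.
  case: p q => [s l] [r' j']; rewrite !inE /entry /= => /andP[lt_r' le_m] lt_T.
  have lt_n := tableaux_next tabT' j' lt_r'.
  (* Bottom row entries are at least [T' ord_max ord0], which exceeds [m]. *)
  have lt_sk : s < k.
    rewrite ltn_neqAle -ltnS ltn_ord andbT; apply/eqP => eq_s.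
    have eq_so : s = ord_max by apply: val_inj.
    have := tableaux_row_le tabT' ord_max (leq0n l : ord0 <= l).
    by move: lt_T; rewrite eq_so; lia.
  (* Otherwise the entry of [q] and its lower neighbour, both in column [j'], would lie between the
     entry of [p] and its lower neighbour. *)
  rewrite lt_sk leqNgt; apply/negP=> lt_ms.
  by apply: (tableaux_avoid tabT' lt_sk lt_T lt_n); lia.
have -> : (T' (next r) j <= m) = ((r, j) \in nonlast m) by rewrite inE /= lt_rk.
have rank : #|[set p | entry T' p <= T' r j]| = T' r j.
  by rewrite (card_entry_le onceT') // leq_ord.
apply/idP/idP => [|in_rj]; last first.
  rewrite -rank; apply/subset_leq_card/subsetP => p; rewrite inE leq_eqVlt.
  by case/predU1P=> [/(entry_inj onceT' (x2 := (r, j)))->//|]; apply: (down _ (r, j)).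
apply: contraTT => notin_rj; rewrite -ltnNge -[X in _ < X]rank.
apply/proper_card/properP; split; last first.
  by exists (r, j) => //; rewrite inE.
apply/subsetP=> p in_p; rewrite inE leqNgt; apply: contra notin_rj.
exact: (down (r, j)).
Qed.

Lemma pred_gap_le m : m <= k.+1 * n.+1 -> pred_gap m <= m.
Proof.
move=> le_m; rewrite -[X in _ <= X](card_entry_le onceT' le_m).
apply/subset_leq_card/subsetP => p; rewrite !inE => /andP[lt_pk].
by apply/leq_trans/ltnW/tableaux_next.
Qed.

Lemma valid_gaps_bound c i : valid_gaps c -> c i <= k.+1 * n.+1.
Proof.
by case=> lt_c _; apply: leq_trans (ltnW (lt_c i)) _; rewrite -ltnS ltn_ord.
Qed.

(** The value [c i] counts the entries [<= c i]. None of them is in the bottom row, by the first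
    clause of [valid_gaps]; in the other rows the second clause identifies their cells with
    [nonlast (c (next i))]. *)
Lemma valid_gaps_next c (i : 'I_k.+1) :
  valid_gaps c -> i < k -> c i = pred_gap (c (next i)).
Proof.
move=> vc lt_ik; have [lt_c step] := vc.
rewrite -[LHS](card_entry_le onceT' (valid_gaps_bound i vc)).
apply: eq_card => -[r j]; rewrite !inE /entry /=.
case: (ltnP r k) => [lt_rk|le_kr]; first by rewrite step.
apply/negbTE; rewrite -ltnNge; apply: leq_trans (lt_c i) _.
apply: leq_trans (tableaux_col_le tabT' ord0 (_ : i <= r)) _; first by lia.
exact: tableaux_row_le.
Qed.

Lemma valid_gaps_iter c i :
  valid_gaps c -> c i = iter (k - i) pred_gap (c ord_max).
Proof.
move=> vc; move def_d : (k - i) => d.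
elim: d i def_d => [|d IHd] i def_d /=.
  by congr c; apply: val_inj => /=; have := ltn_ord i; lia.
have lt_ik : i < k by lia.
by rewrite (valid_gaps_next vc lt_ik) IHd // nextE //; lia.
Qed.

Lemma valid_gaps_mono c (i1 i2 : 'I_k.+1) :
  valid_gaps c -> i1 <= i2 -> c i1 <= c i2.
Proof.
move=> vc; move def_d : (i2 - i1) => d.
elim: d i1 def_d => [|d IHd] i1 def_d le_i.
  by rewrite (_ : i1 = i2) //; apply: val_inj => /=; lia.
have lt_ik : i1 < k by have := ltn_ord i2; lia.
rewrite (valid_gaps_next vc lt_ik).
apply: leq_trans (pred_gap_le (valid_gaps_bound _ vc)) _.
by apply: IHd; rewrite nextE //; lia.
Qed.

Definition gaps_of m (i : 'I_k.+1) := iter (k - i) pred_gap m.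

Lemma gaps_of_max m : gaps_of m ord_max = m.
Proof. by rewrite /gaps_of subnn. Qed.

Lemma gaps_of_next m (i : 'I_k.+1) :
  i < k -> gaps_of m i = pred_gap (gaps_of m (next i)).
Proof. by move=> lt_ik; rewrite /gaps_of nextE // -iterS -subSn // subSS. Qed.

(** The bound by column 0 propagates upwards from the bottom row: [leq_pred_gap] at [j = ord0]
    passes it from [next i] to [i], and the bound itself keeps the hypothesis of [leq_pred_gap]
    true. *)
Lemma gaps_of_valid m : m < T' ord_max ord0 -> valid_gaps (gaps_of m).
Proof.
move=> lt_m.
have lt_c i : gaps_of m i < T' i ord0.
  move def_d : (k - i) => d.
  elim: d i def_d => [|d IHd] i def_d.
    by rewrite (_ : i = ord_max) ?gaps_of_max //; apply: val_inj => /=;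
       have := ltn_ord i; lia.
  have lt_ik : i < k by lia.
  have IHi : gaps_of m (next i) < T' (next i) ord0.
    by apply: IHd; rewrite nextE //; lia.
  rewrite gaps_of_next // ltnNge leq_pred_gap // -?ltnNge //.
  by apply: leq_trans IHi _; apply: tableaux_col_le => //; apply: leq_ord.
split=> // i r j lt_ik lt_rk; rewrite gaps_of_next // leq_pred_gap //.
by apply: leq_trans (lt_c _) _; apply: tableaux_col_le => //; apply: leq_ord.
Qed.

(** * The array built from a gap sequence *)

Definition extend_entry c (i : 'I_k.+1) (j : 'I_n.+2) : nat :=
  if unlift ord0 j is Some j' then T' i j' + #|[set r | c r < T' i j']|
  else c i + i.+1.

Definition extend c : array k n.+2 := \matrix_(i, j) inord (extend_entry c i j).

Lemma extendE c i j : valid_gaps c -> extend c i j = extend_entry c i j :> nat.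
Proof.
move=> vc; rewrite mxE inordK // ltnS /extend_entry.
case: unliftP => [j' _|_]; last first.
  by have := valid_gaps_bound i vc; have := ltn_ord i; nia.
have := ltn_ord (T' i j').
have : #|[set r | c r < T' i j']| <= k.+1.
  by rewrite -[X in _ <= X]card_ord max_card.
by nia.
Qed.

Lemma extend0 c i : valid_gaps c -> extend c i ord0 = c i + i.+1 :> nat.
Proof. by move=> vc; rewrite extendE // /extend_entry unlift_none. Qed.

Lemma extend_lift c i j : valid_gaps c ->
  extend c i (lift ord0 j) = T' i j + #|[set r | c r < T' i j]| :> nat.
Proof. by move=> vc; rewrite extendE // /extend_entry liftK. Qed.

Lemma card_ord_lt (r : 'I_k.+1) : #|[set s : 'I_k.+1 | s < r]| = r.
Proof.
rewrite cardsE -sum1_card -[RHS](card_ord r) -sum1_card.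
by rewrite (big_ord_widen _ (fun=> 1) (ltnW (ltn_ord r))).
Qed.

Lemma extend_lift_le c i j i' j' : valid_gaps c -> T' i j <= T' i' j' ->
  extend c i (lift ord0 j) <= extend c i' (lift ord0 j').
Proof.
move=> vc le_T; rewrite !extend_lift // leq_add //.
by apply/subset_leq_card/subsetP=> r; rewrite !inE => /leq_trans; apply.
Qed.

Lemma extend_lift_lt c i j i' j' : valid_gaps c ->
  (extend c i (lift ord0 j) < extend c i' (lift ord0 j')) = (T' i j < T' i' j').
Proof.
move=> vc; case: (ltnP (T' i j)) => [lt_T|le_T]; last first.
  by apply/negbTE; rewrite -leqNgt extend_lift_le.
rewrite !extend_lift // -addSn leq_add //.
apply/subset_leq_card/subsetP=> r; rewrite !inE => /leq_trans; apply.
exact: ltnW.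
Qed.

(** As [c] is weakly increasing, the rows [s] with [c s < v] form an initial segment. This makes
    comparisons between the new column and the old ones depend on [c] and [T'] alone. *)
Lemma ltn_card_gaps c (r : 'I_k.+1) v :
  valid_gaps c -> (r < #|[set s | c s < v]|) = (c r < v).
Proof.
move=> vc; case: (ltnP (c r)) => [lt_c|le_c].
  rewrite -[X in X < _]card_ord_lt; apply/proper_card/properP; split.
    apply/subsetP=> s; rewrite !inE => /ltnW /(valid_gaps_mono vc).
    by move/leq_ltn_trans; apply.
  by exists r; rewrite inE // ltnn.
apply/negbTE; rewrite -leqNgt -[X in _ <= X]card_ord_lt.
apply/subset_leq_card/subsetP => s; rewrite !inE => lt_s.
by rewrite ltnNge; apply/negP => /(valid_gaps_mono vc); lia.
Qed.

Lemma extend0_lt_lift c r i j : valid_gaps c ->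
  (extend c r ord0 < extend c i (lift ord0 j)) = (c r < T' i j).
Proof.
move=> vc; rewrite extend0 // extend_lift //.
by have := ltn_card_gaps r (T' i j) vc; lia.
Qed.

Lemma extend_lift_lt0 c r i j : valid_gaps c ->
  (extend c i (lift ord0 j) < extend c r ord0) = (T' i j <= c r).
Proof.
move=> vc; rewrite extend0 // extend_lift //.
by have := ltn_card_gaps r (T' i j) vc; lia.
Qed.

Lemma extend0_lt c (r s : 'I_k.+1) : valid_gaps c ->
  (extend c r ord0 < extend c s ord0) = (r < s).
Proof.
move=> vc; rewrite !extend0 //.
have [lt_rs|le_sr] := ltnP r s.
  by have := valid_gaps_mono vc (ltnW lt_rs); lia.
by have := valid_gaps_mono vc le_sr; lia.
Qed.

Lemma extend_each_once c : valid_gaps c -> each_once (extend c).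
Proof.
move=> vc; apply: each_once_inj => [[i j]|].
  rewrite /entry /=; case: (unliftP ord0 j) => [j' ->|->].
    by rewrite extend_lift // addn_gt0 (entry_gt0 onceT').
  by rewrite extend0 // addnS.
case=> [i j] [i' j']; rewrite /entry /=.
case: (unliftP ord0 j) => [l ->|->]; case: (unliftP ord0 j') => [l' ->|->] eqT.
- have := extend_lift_lt i l i' l' vc; have := extend_lift_lt i' l' i l vc.
  rewrite eqT ltnn => /esym/negbT; rewrite -leqNgt => le1.
  move/esym/negbT; rewrite -leqNgt => le2.
  have eqT' : entry T' (i, l) = entry T' (i', l').
    by apply/eqP; rewrite eqn_leq le1 le2.
  by have [-> ->] := entry_inj onceT' eqT'.
- have := extend_lift_lt0 i' i l vc; have := extend0_lt_lift i' i l vc.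
  by rewrite eqT ltnn; lia.
- have := extend_lift_lt0 i i' l' vc; have := extend0_lt_lift i i' l' vc.
  by rewrite eqT ltnn; lia.
have := extend0_lt i i' vc; have := extend0_lt i' i vc.
rewrite eqT ltnn => ? ?; congr (_, _); apply: val_inj => /=; lia.
Qed.

Lemma extend_tableaux c : valid_gaps c -> extend c \in tableaux k n.+2.
Proof.
move=> vc; have [lt_c step] := vc.
have colT (i1 i2 : 'I_k.+1) j : i1 < i2 -> extend c i1 j < extend c i2 j.
  move=> lt_i; case: (unliftP ord0 j) => [l ->|->]; last by rewrite extend0_lt.
  by rewrite extend_lift_lt //; apply: tableaux_col.
have colP (i1 i2 : 'I_k.+1) j : extend c i1 j < extend c i2 j -> i1 < i2.
  apply: contraTT; rewrite -!leqNgt leq_eqVlt.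
  by case/predU1P=> [/val_inj->//|/colT/ltnW].
rewrite inE; apply/and4P; split; first exact: extend_each_once.
- apply/forallP=> i; apply/forallP=> j1; apply/forallP=> j2; apply/implyP.
  case: (unliftP ord0 j2) => [l2 ->|->//]; case: (unliftP ord0 j1) => [l1 ->|-> _].
    rewrite extend_lift_lt // !lift0 ltnS; exact: tableaux_row.
  rewrite extend0_lt_lift //; apply: leq_trans (lt_c i) _.
  exact: tableaux_row_le.
- by apply/forallP=> j; apply/forallP=> i1; apply/forallP=> i2; apply/implyP/colT.
apply/forallP=> i; apply/forallP=> i'; apply/forallP=> j; apply/forallP=> l.
apply/forallP=> r; apply/forallP=> s; apply/implyP=> /eqP def_i'.
have lt_ik : i < k by have := ltn_ord i'; lia.
have {def_i'}-> : i' = next i by apply: val_inj; rewrite /= nextE.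
(* Since [r < s], row [r] has a row below it, and [c] and the columns of [T'] can be compared at
   [next r <= s]. *)
apply/negP => /and3P[h1 h2 h3]; have lt_rs := colP _ _ _ h2.
have lt_rk : r < k by have := ltn_ord s; lia.
have le_nrs : next r <= s by rewrite nextE.
(* Two old columns reduce to avoidance in [T']; in the two mixed cases the second clause of
   [valid_gaps] contradicts the pattern; with both columns new, no two rows fit strictly between [i]
   and [next i]. *)
case: (unliftP ord0 j) h1 h3 => [j' ->|->];
  case: (unliftP ord0 l) h2 => [l' ->|->].
- rewrite !extend_lift_lt //; move=> h2 h1 h3.
  exact: (tableaux_avoid tabT' lt_ik h1 h2 h3).
- rewrite extend_lift_lt0 // extend0_lt_lift // => _.
  rewrite step // => h1 h3; have := valid_gaps_mono vc le_nrs; lia.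
- rewrite extend0_lt_lift // extend_lift_lt0 // => _ h1 h3.
  have := tableaux_col_le tabT' l' le_nrs; have := step i r l' lt_ik lt_rk; lia.
by rewrite !extend0_lt // nextE //; lia.
Qed.

Lemma red_extend c : valid_gaps c -> red (extend c) = T'.
Proof.
move=> vc; apply/matrixP=> i j; apply/val_inj; rewrite /= red_rankE.
transitivity #|[set p | entry T' p <= T' i j]|.
  apply: eq_card => p; rewrite !inE leqNgt extend_lift_lt //.
  by rewrite -leqNgt.
by rewrite (card_entry_le onceT') // -ltnS ltn_ord.
Qed.

Lemma bottom_extend0 c :
  valid_gaps c -> bottom (extend c) ord0 = c ord_max + k.+1.
Proof. by move=> vc; rewrite /bottom extend0. Qed.

(** * Recovering a tableau from its gaps *)

Section Reduced.
Variable T : array k n.+2.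
Hypotheses (tabT : T \in tableaux k n.+2) (redT : red T = T').

Let onceT := tableaux_each_once tabT.

Definition gap (i : 'I_k.+1) : nat :=
  #|[set p : 'I_k.+1 * 'I_n.+1 | T p.1 (lift ord0 p.2) < T i ord0]|.

Lemma red_lift_rank i j :
  T' i j = #|[set p : 'I_k.+1 * 'I_n.+1 |
               T p.1 (lift ord0 p.2) <= T i (lift ord0 j)]| :> nat.
Proof. by rewrite -redT red_rankE. Qed.

Lemma col0_neq_lift r i j : T r ord0 != T i (lift ord0 j) :> nat.
Proof.
by apply/eqP=> /(entry_inj onceT (x1 := (r, _)) (x2 := (i, _)))[].
Qed.

(** Both numbers on the left count old entries of [T] below a threshold, so the order of the
    thresholds decides; strictness comes from the cell [(i, j)] itself. *)
Lemma gap_lt r i j : (gap r < T' i j) = (T r ord0 < T i (lift ord0 j)).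
Proof.
rewrite red_lift_rank; case: (ltnP (T r ord0)) => [lt_T|le_T].
  apply/proper_card/properP; split.
    apply/subsetP=> p; rewrite !inE => /ltnW/leq_trans; apply; exact: ltnW.
  by exists (i, j); rewrite !inE //= -leqNgt ltnW.
apply/negbTE; rewrite -leqNgt; apply/subset_leq_card/subsetP=> p.
rewrite !inE => /leq_ltn_trans; apply.
by rewrite ltn_neqAle le_T andbT eq_sym col0_neq_lift.
Qed.

Lemma gap_ge r i j : (T' i j <= gap r) = (T i (lift ord0 j) < T r ord0).
Proof.
by rewrite leqNgt gap_lt -leqNgt ltn_neqAle eq_sym col0_neq_lift.
Qed.

Lemma gap_valid : valid_gaps gap.
Proof.
split=> [i|i r j lt_ik lt_rk]; first by rewrite gap_lt; apply: tableaux_row.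
(* If either implication failed, two adjacent entries of one column would lie between two adjacent
   entries of the other: the outer pair is in the old column for the first, in the new column for
   the second. *)
rewrite !gap_ge; apply/idP/idP => lt_T.
  rewrite ltnNge leq_eqVlt negb_or col0_neq_lift -leqNgt leqNgt.
  apply/negP=> lt_T'.
  exact: (tableaux_avoid tabT lt_rk lt_T (tableaux_next tabT ord0 lt_ik)).
rewrite ltnNge leq_eqVlt negb_or col0_neq_lift -leqNgt leqNgt.
apply/negP=> lt_T'.
exact: (tableaux_avoid tabT lt_ik lt_T' (tableaux_next tabT _ lt_rk)).
Qed.

Lemma entry_rank_split v : v <= k.+1 * n.+2 ->
  v = #|[set r | T r ord0 <= v]| +
      #|[set p : 'I_k.+1 * 'I_n.+1 | T p.1 (lift ord0 p.2) <= v]|.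
Proof.
move=> le_v; rewrite -[LHS](card_entry_le onceT le_v).
exact: (card_cells_split (fun p => entry T p <= v)).
Qed.

(** Each entry of [T] is its rank, the sum of a count over the first column and one over the old
    columns. These are the two summands of [extend_entry]. *)
Lemma extend_gap : extend gap = T.
Proof.
have vg := gap_valid; apply/matrixP=> i j; apply/val_inj => /=.
case: (unliftP ord0 j) => [l ->|->].
  rewrite extend_lift // [RHS](entry_rank_split (leq_ord _)).
  rewrite -red_lift_rank addnC; congr (_ + _).
  apply: eq_card => r; rewrite !inE gap_lt [RHS]leq_eqVlt.
  by rewrite (negbTE (col0_neq_lift _ _ _)).
rewrite extend0 // [RHS](entry_rank_split (leq_ord _)) addnC.
congr (_ + _); last first.
  apply: eq_card => p; rewrite !inE [RHS]leq_eqVlt eq_sym.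
  by rewrite (negbTE (col0_neq_lift _ _ _)).
transitivity #|[set r : 'I_k.+1 | r <= i]|.
  rewrite (_ : [set r : 'I_k.+1 | r <= i] = i |: [set r : 'I_k.+1 | r < i]).
    by rewrite cardsU1 inE ltnn card_ord_lt.
  by apply/setP=> r; rewrite !inE leq_eqVlt.
apply: eq_card => r; rewrite !inE; apply/idP/idP => [|].
  exact: tableaux_col_le.
by apply: contraTT; rewrite -!ltnNge; apply: tableaux_col.
Qed.

Lemma gaps_of_gap : gaps_of (gap ord_max) =1 gap.
Proof. by move=> i; rewrite [RHS]valid_gaps_iter //; apply: gap_valid. Qed.

Lemma gap_max_lt : gap ord_max < bottom T' ord0.
Proof. by case: gap_valid. Qed.

Lemma bottom0_gap : bottom T ord0 = gap ord_max + k.+1.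
Proof. by rewrite -[in LHS]extend_gap bottom_extend0 //; apply: gap_valid. Qed.

(** Every gap is at most the last one, which is below [bottom T' ord0]; so all [k.+1] new entries
    lie below each old bottom entry. *)
Lemma bottom_lift j : bottom T (lift ord0 j) = bottom T' j + k.+1.
Proof.
have vg := gap_valid.
rewrite /bottom -[in LHS]extend_gap extend_lift //; congr (_ + _).
rewrite -[RHS]card_ord -cardsT; apply: eq_card => r; rewrite !inE.
apply: leq_ltn_trans (valid_gaps_mono vg (leq_ord r : r <= ord_max)) _.
exact: leq_trans gap_max_lt (tableaux_row_le tabT' _ (leq0n j : ord0 <= j)).
Qed.

End Reduced.

(** * Parametrisation by the bottom gap and the count *)

Lemma eq_extend c c' : c =1 c' -> extend c = extend c'.
Proof.
move=> eq_c; apply/matrixP=> i j; rewrite !mxE /extend_entry eq_c.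
case: unlift => // l; congr (inord (_ + _)).
by apply: eq_card => r; rewrite !inE eq_c.
Qed.

(** The bottom entry reveals the last gap, which determines all gaps and hence [T]. This serves both
    the count and the unique existence. *)
Lemma extend_gaps_ofP m T : m < bottom T' ord0 ->
  T = extend (gaps_of m) <->
  [/\ T \in tableaux k n.+2, red T = T' & bottom T ord0 = m + k.+1].
Proof.
move=> lt_m; have vm := gaps_of_valid lt_m; split=> [->|[tabT redT botT]].
  by rewrite extend_tableaux // red_extend // bottom_extend0 // gaps_of_max.
rewrite -[LHS](extend_gap tabT redT); apply: eq_extend => i.
rewrite -(gaps_of_gap tabT redT); congr gaps_of.
by move: botT; rewrite (bottom0_gap tabT redT) => /addIn.
Qed.

End Extension.

Theorem theorem4p4 (k n : nat) (hk : 1 <= k) (T' : array k n.+1)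
    (hT' : T' \in tableaux k n.+1) :
  [/\ #|[set T in tableaux k n.+2 | red T == T']| = bottom T' ord0,
      forall T : array k n.+2, T \in tableaux k n.+2 -> red T = T' ->
        (forall j : 'I_n.+1, bottom T (lift ord0 j) = bottom T' j + k + 1) /\
        k + 1 <= bottom T ord0 <= k + bottom T' ord0
    & forall m : nat, k + 1 <= m <= k + bottom T' ord0 ->
        exists! T : array k n.+2,
          [/\ T \in tableaux k n.+2, red T = T' & bottom T ord0 = m]].
Proof.
split=> [|T tabT redT|m le_m].
- pose f (m : 'I_(bottom T' ord0)) := extend T' (gaps_of T' m).
  have fP m := (extend_gaps_ofP hT' _ (ltn_ord m)).1 (erefl (f m)).
  (* The parameter is read off from the bottom entry of the first column. *)
  have inj_f : injective f.
    move=> m1 m2 eq_f; have [_ _] := fP m1; have [_ _] := fP m2.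
    by rewrite eq_f => -> /addIn/val_inj.
  rewrite -[RHS]card_ord -cardsT -(card_imset _ inj_f); apply: eq_card => T.
  rewrite [LHS]in_set.
  apply/andP/imsetP => [[tabT /eqP redT]|[m _ ->]]; last first.
    by have [tab_f red_f _] := fP m; rewrite red_f.
  exists (Ordinal (gap_max_lt tabT redT)) => //.
  apply/(extend_gaps_ofP hT' _ (gap_max_lt tabT redT)).
  by rewrite -(bottom0_gap hT' tabT redT).
- split=> [j|]; first by rewrite (bottom_lift hT' tabT redT) addn1 addnS.
  by rewrite (bottom0_gap hT' tabT redT); have := gap_max_lt tabT redT; lia.
(* The truncated subtraction is exact because [k + 1 <= m]. *)
have lt_m : m - k.+1 < bottom T' ord0 by lia.
have mP T := extend_gaps_ofP hT' T lt_m.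
have def_m : m - k.+1 + k.+1 = m by lia.
rewrite def_m in mP.
by exists (extend T' (gaps_of T' (m - k.+1))); split=> [|T]; rewrite -mP.
Qed.
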